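(* Let $A=K[x_1,x_2,\ldots,x_n]$ be the polynomial algebra over a field $K$ of characteristic zero in $n\geq 2$ variables $x_1,\ldots,x_n$, let $d\geq 2$, and let $A_0$ be the Veronese subalgebra of $A$ of degree $d$. Then every locally nilpotent derivation of $A_0$ is induced by (i.e. is the restriction to $A_0$ of) a locally nilpotent $d$-graded derivation of $K[x_1,x_2,\ldots,x_n]$.
   Context: For $0\le i\le d-1$ let $A_i$ be the $K$-linear span of all monomials of $A$ of total degree $kd+i$, $k\geq 0$; then $A=A_0\oplus A_1\oplus\cdots\oplus A_{d-1}$ is a $\mathbb{Z}/d\mathbb{Z}$-grading. The subalgebra $A_0$ is the Veronese subalgebra of $A$ of degree $d$. Derivations are $K$-linear. A derivation $D$ of an algebra $R$ is locally nilpotent if for every $a\in R$ there is $m\geq 1$ with $D^m(a)=0$. A derivation $D$ of $A$ is called $d$-graded if $D(x_1),\ldots,D(x_n)\in A_1$. *)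

(* Defs.v *)
From HB Require Import structures.
From mathcomp Require Import all_boot all_order all_algebra.
From mathcomp Require Export mpoly.

Set Implicit Arguments.
Unset Strict Implicit.
Unset Printing Implicit Defensive.

Import GRing.Theory.
Local Open Scope ring_scope.

Section GradedPart.
Variables (K : fieldType) (n d : nat).

(* The component A_i of the Z/dZ-grading: the span of the monomials of total
   degree congruent to i mod d, encoded as a boolean condition on the support;
   [graded_partP] below gives the description as a linear span. *)
Definition graded_part (i : nat) : {pred {mpoly K[n]}} :=
  fun p => all (fun m => mdeg m == i %[mod d])%N (msupp p).

Lemma graded_part_suppP i (p : {mpoly K[n]}) :
  reflect {in msupp p, forall m, mdeg m = i %[mod d]}%N (p \in graded_part i).
Proof.
by apply: (iffP allP) => h m /h => [/eqP //|hm]; apply/eqP.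
Qed.

Fact graded_part_addr_closed i : addr_closed (graded_part i).
Proof.
split=> [|p q /graded_part_suppP hp /graded_part_suppP hq].
  by apply/graded_part_suppP => m; rewrite msupp0.
apply/graded_part_suppP => m /msuppD_le; rewrite mem_cat.
by case/orP; [apply: hp | apply: hq].
Qed.

Fact graded_part_scaler_closed i : GRing.scaler_closed (graded_part i).
Proof.
move=> c p /graded_part_suppP hp.
by apply/graded_part_suppP => m /msuppZ_le; apply: hp.
Qed.

HB.instance Definition _ i := GRing.isAddClosed.Build {mpoly K[n]}
  (graded_part i) (graded_part_addr_closed i).
HB.instance Definition _ i := GRing.isScaleClosed.Build K {mpoly K[n]}
  (graded_part i) (@graded_part_scaler_closed i).

Lemma graded_partX i (m : 'X_{1..n}) :
  ('X_[m] \in graded_part i) = (mdeg m == i %[mod d])%N.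
Proof. by rewrite unfold_in msuppX /= andbT. Qed.

Lemma graded_partM i j p q :
  p \in graded_part i -> q \in graded_part j -> p * q \in graded_part (i + j).
Proof.
move=> /graded_part_suppP hp /graded_part_suppP hq.
apply/graded_part_suppP => m /msuppM_le /allpairsP [[m1 m2] /= [h1 h2 ->]].
by rewrite mdegD -modnDm (hp _ h1) (hq _ h2) modnDm.
Qed.

Lemma graded_partP i (p : {mpoly K[n]}) :
  p \in graded_part i <->
  exists2 s : seq (K * 'X_{1..n}),
    {in s, forall t, mdeg t.2 = i %[mod d]}%N
    & p = \sum_(t <- s) t.1 *: 'X_[t.2].
Proof.
split=> [/graded_part_suppP hp | [s hs ->]].
  exists [seq (p@_m, m) | m <- msupp p]; last by rewrite big_map -mpolyE.
  by move=> t /mapP [m hm ->]; apply: hp.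
rewrite big_seq; apply: rpred_sum => t /hs ht.
by apply: rpredZ; rewrite graded_partX; apply/eqP.
Qed.

Fact graded_part0_mulr_closed : mulr_closed (graded_part 0).
Proof.
split; last by move=> p q hp hq; have := graded_partM hp hq.
by apply/graded_part_suppP => m; rewrite msupp1 inE => /eqP ->; rewrite mdeg0.
Qed.

HB.instance Definition _ := GRing.isMulClosed.Build {mpoly K[n]}
  (graded_part 0) graded_part0_mulr_closed.

Record veronese := Veronese {
  veronese_val :> {mpoly K[n]};
  _ : veronese_val \in graded_part 0 }.

HB.instance Definition _ := [isSub for veronese_val].
HB.instance Definition _ := [Choice of veronese by <:].
HB.instance Definition _ := [SubChoice_isSubAlgebra of veronese by <:].
HB.instance Definition _ := [SubNzRing_isSubComNzRing of veronese by <:].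

Fact veronese_val_is_linear : linear veronese_val.
Proof. by []. Qed.

Fact veronese_val_is_monoid_morphism : monoid_morphism veronese_val.
Proof. by []. Qed.

HB.instance Definition _ := GRing.isLinear.Build K veronese {mpoly K[n]} _
  veronese_val veronese_val_is_linear.
HB.instance Definition _ := GRing.isMonoidMorphism.Build veronese {mpoly K[n]}
  veronese_val veronese_val_is_monoid_morphism.

End GradedPart.

Arguments graded_part {K n} d i.

Section Derivations.
Variables (K : fieldType) (R : algType K).

Definition derivation (D : {linear R -> R}) : Prop :=
  forall a b : R, D (a * b) = D a * b + a * D b.

Definition locally_nilpotent (D : {linear R -> R}) : Prop :=
  forall a : R, exists2 m : nat, (0 < m)%N & iter m D a = 0.

End Derivations.

Definition d_graded (K : fieldType) (n d : nat)
    (D : {linear {mpoly K[n]} -> {mpoly K[n]}}) : Prop :=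
  forall i : 'I_n, D 'X_i \in graded_part d 1.

(* Main.v *)
(* Write x_i for the variables. In A_0 one has w^d = u v^(d-1) with u = x_i^d,
   v = x_j^d and w = x_i x_j^(d-1), where j <> i; differentiating, x_i^(d-1)
   divides x_j^(d(d-1)) D(u), hence it divides D(u). So
   E(x_i) = D(x_i^d) / (d x_i^(d-1)) is a polynomial, and E extends D because
   every monomial of A_0 has a d-th power that is a product of the x_i^d.

   For the local nilpotence of E, let f = x_i and let N be the degree of f^d
   with respect to the filtration of the E-nilpotent elements by the kernels of
   the iterates of E; this degree is additive on products. In fractions,
   E^m(f) = f h_m where h_m has degree at most -m. Hence E^m(f)^d, an element
   of A_0, has degree at most N - m d as soon as it is nonzero, which is
   impossible for large m. *)

Require Import Defs.
From mathcomp Require Import all_boot all_order all_algebra.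
From HB Require Import structures.
From mathcomp Require Import ring zify.

Set Implicit Arguments.
Unset Strict Implicit.
Unset Printing Implicit Defensive.

Import GRing.Theory.
Local Open Scope ring_scope.

(** * Iterates of a derivation of a commutative ring *)

Section Leibniz.
Variables (R : comNzRingType) (E : {additive R -> R}).
Hypothesis leibniz : forall a b, E (a * b) = E a * b + a * E b.

Lemma leibniz1 : E 1 = 0.
Proof.
by apply: (@addrI _ (E 1)); rewrite addr0 -[in RHS](mulr1 1) leibniz mulr1 mul1r.
Qed.

Lemma leibnizX a n : E (a ^+ n) = (a ^+ n.-1 * E a) *+ n.
Proof.
case: n => [|n] /=; first by rewrite expr0 leibniz1.
elim: n => [|n IH]; first by rewrite expr1 expr0 mul1r.
rewrite exprS leibniz {}IH -mulrnAr mulrA -exprS [E a * _]mulrC.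
by ring.
Qed.

Lemma iter_raddf0 n : iter n E 0 = 0.
Proof. by elim: n => //= n ->; rewrite raddf0. Qed.

Lemma iter_raddfD n a b : iter n E (a + b) = iter n E a + iter n E b.
Proof. by elim: n => //= n ->; rewrite raddfD. Qed.

Lemma iter_raddfMn n a k : iter n E (a *+ k) = iter n E a *+ k.
Proof. by elim: n => //= n ->; rewrite raddfMn. Qed.

Lemma iter_raddfB n a b : iter n E (a - b) = iter n E a - iter n E b.
Proof. by elim: n => //= n ->; rewrite raddfB. Qed.

Lemma iter_eq0_leq n m a : (n <= m)%N -> iter n E a = 0 -> iter m E a = 0.
Proof. by move=> /subnK <- an; rewrite iterD an iter_raddf0. Qed.

(** Pigeonhole in the iterated Leibniz rule: if [i + j = n], then [p <= i] or [q <= j], so every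
    term vanishes. *)
Lemma iterM_eq0 n p q a b : (p + q <= n.+1)%N ->
  iter p E a = 0 -> iter q E b = 0 -> iter n E (a * b) = 0.
Proof.
elim: n p q a b => [|n IH] [|p] [|q] a b le_pq ap bq;
  try by rewrite [a]ap mul0r iter_raddf0.
- by rewrite [b]bq mulr0 iter_raddf0.
- by rewrite addnS in le_pq.
- by rewrite [b]bq mulr0 iter_raddf0.
rewrite iterSr leibniz iter_raddfD.
rewrite (IH p q.+1 (E a) b _ _ bq) ?(IH p.+1 q a (E b) _ ap) ?addr0 //; try lia.
- by move: bq; rewrite iterSr.
- by move: ap; rewrite iterSr.
Qed.

(** Only one term of the iterated Leibniz rule survives in this top order. A double induction with
    Pascal's rule avoids writing out the whole sum. *)
Lemma iterM_top p q a b : iter p.+1 E a = 0 -> iter q.+1 E b = 0 ->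
  iter (p + q) E (a * b) = (iter p E a * iter q E b) *+ 'C(p + q, p).
Proof.
elim: p a q b => [|p IHp] a q b ap bq.
  rewrite bin0 mulr1n add0n; elim: q {bq} => [|k IHk]; [by []|].
  by rewrite iterS IHk leibniz [E a]ap mul0r add0r.
elim: q b bq => [|q IHq] b bq.
  rewrite addn0 binn mulr1n; elim: p.+1 => [|k IHk]; [by []|].
  by rewrite iterS IHk leibniz [E b]bq mulr0 addr0.
rewrite addSn iterSr leibniz iter_raddfD binS mulrnDr addrC; congr (_ + _).
  by rewrite -addSnnS IHq -?iterSr.
by rewrite IHp -?iterSr.
Qed.

Definition nilpotent_at a := exists n, iter n E a = 0.

Lemma nilpotent_atD a b :
  nilpotent_at a -> nilpotent_at b -> nilpotent_at (a + b).
Proof.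
move=> [p ap] [q bq]; exists (p + q)%N.
rewrite iter_raddfD (iter_eq0_leq _ ap) ?leq_addr //.
by rewrite (iter_eq0_leq _ bq) ?leq_addl ?addr0.
Qed.

Lemma nilpotent_atM a b :
  nilpotent_at a -> nilpotent_at b -> nilpotent_at (a * b).
Proof. by move=> [p ap] [q bq]; exists (p + q)%N; apply: iterM_eq0 ap bq. Qed.

Lemma nilpotent_at_prod (I : Type) (r : seq I) (P : pred I) (F : I -> R) :
  (forall i, nilpotent_at (F i)) -> nilpotent_at (\prod_(i <- r | P i) F i).
Proof.
move=> nilF; apply: big_ind => // [|a b]; last exact: nilpotent_atM.
by exists 1%N; apply: leibniz1.
Qed.

End Leibniz.

(** * The degree given by a derivation of a domain of characteristic zero *)

Section Domain.
Variables (R : idomainType) (E : {additive R -> R}).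
Hypothesis charR : [pchar R] =i pred0.
Hypothesis leibniz : forall a b, E (a * b) = E a * b + a * E b.

Let natr_neq0 n : (0 < n)%N -> n%:R != 0 :> R.
Proof. by rewrite (pcharf0P _).1 // -lt0n. Qed.

Definition nildeg (n : nat) (a : R) := iter n E a != 0 /\ iter n.+1 E a = 0.

Lemma nildegP a : nilpotent_at E a -> a != 0 -> exists n, nildeg n a.
Proof.
case; elim=> [/= -> /eqP //|n IH an a0].
by have [/IH/(_ a0) //|an0] := eqVneq (iter n E a) 0; exists n.
Qed.

Lemma nildeg_leq n m a : nildeg n a -> iter m.+1 E a = 0 -> (n <= m)%N.
Proof.
move=> [an _] am; rewrite leqNgt; apply: contra an => lt_mn.
by rewrite (iter_eq0_leq lt_mn am).
Qed.

(** The top term is a binomial coefficient times two nonzero factors; it is nonzero in a domain of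
    characteristic zero. *)
Lemma nildegM p q a b : nildeg p a -> nildeg q b -> nildeg (p + q) (a * b).
Proof.
move=> [ap0 ap] [bq0 bq]; split; last first.
  by apply: (iterM_eq0 leibniz) ap bq; lia.
rewrite (iterM_top leibniz) // -mulr_natr !mulf_neq0 //.
by rewrite natr_neq0 // bin_gt0 leq_addr.
Qed.

Lemma nildegX p a k : nildeg p a -> nildeg (k * p) (a ^+ k).
Proof.
move=> ap; elim: k => [|k IH]; last by rewrite exprS mulSn; apply: nildegM.
by split; [rewrite expr0 oner_neq0 | rewrite expr0 /= leibniz1].
Qed.

Lemma nildeg_uniq p q a : nildeg p a -> nildeg q a -> p = q.
Proof.
move=> ap aq; apply/eqP.
by rewrite eqn_leq (nildeg_leq ap aq.2) (nildeg_leq aq ap.2).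
Qed.

(** This is [E^m(f) = f h_m] with denominators cleared: [h_m] is [a] over the [m]-th power of
    [f ^+ d.+1 *+ d.+1]. When [f ^+ d.+1] has degree exactly [N.+1], the bound [m * N] on the degree
    of [a] gives [h_m] degree at most [-m]. *)
Lemma iter_root_quotient (d N : nat) (f : R) : iter N.+2 E (f ^+ d.+1) = 0 ->
  forall m, exists2 a, iter (m * N).+1 E a = 0 &
    (f ^+ d.+1 *+ d.+1) ^+ m * iter m E f = f * a.
Proof.
set u := f ^+ d.+1 => uN; elim=> [|m [a am Da]].
  by exists 1; rewrite /= ?leibniz1 // expr0 mul1r mulr1.
set v := u *+ d.+1 in Da *.
have Ev : E v = E u *+ d.+1 by rewrite raddfMn.
have fEu : v * E f = f * E u.
  by rewrite /v /u leibnizX //= exprS; ring.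
have EvX : v * E (v ^+ m) = v ^+ m * E v *+ m.
  rewrite leibnizX //; case: m {am Da} => [|m] /=.
    by rewrite !mulr0n mulr0.
  by rewrite exprS; ring.
(* Obtained by applying [E] to [Da], multiplying by [v], and replacing [v * E f] by [f * E u]. *)
exists (E u * a - E u * a *+ (m * d.+1) + u * E a *+ d.+1).
  have Eua : iter (m.+1 * N).+1 E (E u * a) = 0.
    apply: (iterM_eq0 leibniz (p := N.+1)) am; [by lia | by rewrite -iterSr].
  have uEa : iter (m.+1 * N).+1 E (u * E a) = 0.
    apply: (iterM_eq0 leibniz (q := m * N)) uN _; [by lia | by rewrite -iterSr].
  rewrite iter_raddfD iter_raddfB !iter_raddfMn Eua uEa.
  by rewrite !mul0rn subr0 addr0.
have := congr1 (fun x => v * E x) Da.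
rewrite /= !leibniz !mulrDr !mulrA fEu EvX Ev.
rewrite exprS => H.
apply: (addrI (v ^+ m * (E u *+ d.+1) *+ m * iter m E f)); rewrite H.
have -> : v ^+ m * (E u *+ d.+1) *+ m * iter m E f =
    (v ^+ m * iter m E f) * E u *+ (m * d.+1).
  by ring.
by rewrite Da /v; ring.
Qed.

Lemma nilpotent_at_root (d : nat) (f : R) : (1 < d)%N ->
  nilpotent_at E (f ^+ d) -> (forall m, nilpotent_at E (iter m E f ^+ d)) ->
  nilpotent_at E f.
Proof.
case: d => // d d_gt1 nil_u nil_it.
have [->|f0] := eqVneq f 0; first by exists 0.
have [N uN] := nildegP nil_u (expf_neq0 d.+1 f0).
(* From here on the exponent is [d.+1]. In degree zero, [E] kills [f ^+ d.+1], hence kills [f]. *)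
case: N uN => [|N] uN.
  exists 1%N; apply/eqP; have /eqP := uN.2.
  rewrite /= leibnizX // -mulr_natr !mulf_eq0 expf_eq0 (negPf f0) andbF /=.
  by rewrite (negPf (natr_neq0 _)) // orbF.
exists N.+1; apply/eqP/negPn/negP => it0.
have [k itk] := nildegP (nil_it N.+1) (expf_neq0 d.+1 it0).
have [a aN Da] := iter_root_quotient uN.2 N.+1.
set v := f ^+ d.+1 *+ d.+1 in Da.
have vN : nildeg N.+1 v.
  split; rewrite iter_raddfMn; last by rewrite uN.2 mul0rn.
  by rewrite -mulr_natr mulf_neq0 ?natr_neq0 // uN.1.
have v0 : v != 0.
  by apply: contraNneq vN.1 => ->; rewrite iter_raddf0.
have a0 : a != 0.
  apply: contraNneq it0 => a0; move/eqP: Da.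
  by rewrite a0 mulr0 mulf_eq0 expf_eq0 (negPf v0) andbF.
have [l al] := nildegP (ex_intro _ _ aN) a0.
have le_l := nildeg_leq al aN.
have lhs := nildegM (nildegX d.+1 (nildegX N.+1 vN)) itk.
have rhs := nildegM uN (nildegX d.+1 al).
rewrite -!exprMn Da in lhs; rewrite -exprMn in rhs.
(* With [m = N.+1], both degrees of the [d.+1]-th power of [Da] give
   [d.+1 * m * N.+1 + k = N.+1 + d.+1 * l] where [l <= m * N]. Hence [d.+1 * N.+1 <= N.+1], which
   contradicts [0 < d]. *)
have := nildeg_uniq lhs rhs; nia.
Qed.

End Domain.

(** * Graded components and divisibility by powers of a variable *)

Lemma eq_graded_part (K : fieldType) (n d i j : nat) (p : {mpoly K[n]}) :
  (i = j %[mod d])%N -> (p \in graded_part d i) = (p \in graded_part d j).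
Proof.
by move=> eq_ij; rewrite !unfold_in; apply: eq_all => m; rewrite eq_ij.
Qed.

Lemma graded_partXn (K : fieldType) (n d i k : nat) (p : {mpoly K[n]}) :
  p \in graded_part d i -> p ^+ k \in graded_part d (k * i).
Proof.
move=> pi; elim: k => [|k IH]; last by rewrite exprS mulSn graded_partM.
by rewrite expr0 mul0n rpred1.
Qed.

Lemma graded_partMX (K : fieldType) (n d i : nat) (p : {mpoly K[n]}) m :
  (p * 'X_[m] \in graded_part d (i + mdeg m)) = (p \in graded_part d i).
Proof.
rewrite !unfold_in (perm_all _ (msuppMX p m)) all_map; apply: eq_all => k /=.
by rewrite mdegD addnC eqn_modDr.
Qed.

Lemma mpolyXn_dvd_coprime (R : comNzRingType) (n : nat) (i j : 'I_n)
    (a b : nat) (p q : {mpoly R[n]}) :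
  i != j -> 'X_i ^+ a * q = 'X_j ^+ b * p -> exists r, p = r * 'X_i ^+ a.
Proof.
rewrite !mpolyXn => neq_ij eq_qp.
(* Multiplying by a power of ['X_j] leaves the exponent of ['X_i] unchanged in each monomial. *)
have ge_a m : m \in msupp p -> (U_(i) *+ a <= m)%MM.
  move=> mp; have : (m + U_(j) *+ b)%MM \in msupp ('X_[(U_(i) *+ a)] * q).
    rewrite eq_qp mulrC (perm_mem (msuppMX _ _)) [X in X \in _]addmC.
    by apply: map_f.
  rewrite mulrC (perm_mem (msuppMX _ _)) => /mapP [k _] /mnmP Dm.
  apply/mnm_lepP => l; rewrite mulmnE mnm1E; case: eqP => // <-.
  have := Dm i; rewrite !mnmDE !mulmnE !mnm1E eqxx.
  by rewrite [j == i]eq_sym (negPf neq_ij); lia.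
exists (\sum_(m <- msupp p) p@_m *: 'X_[m - U_(i) *+ a]).
rewrite {1}[p]mpolyE mulr_suml !big_seq; apply: eq_bigr => m /ge_a le_am.
by rewrite -scalerAl -mpolyXD submK.
Qed.

(** * Derivations of the polynomial ring with prescribed values on the variables *)

Section DerivationAlong.
Variables (R : comNzRingType) (n : nat) (F : 'I_n -> {mpoly R[n]}).

Definition mderiv_along (p : {mpoly R[n]}) := \sum_i F i * p^`M(i).

Fact mderiv_along_is_linear : linear mderiv_along.
Proof.
move=> c p q; rewrite /mderiv_along scaler_sumr -big_split /=.
by apply: eq_bigr => i _; rewrite mderivD mderivZ mulrDr -scalerAr.
Qed.

HB.instance Definition _ := GRing.isLinear.Build R {mpoly R[n]} {mpoly R[n]} _
  mderiv_along mderiv_along_is_linear.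

Lemma mderiv_alongM p q :
  mderiv_along (p * q) = mderiv_along p * q + p * mderiv_along q.
Proof.
rewrite /mderiv_along mulr_suml mulr_sumr -big_split /=.
by apply: eq_bigr => i _; rewrite mderivM mulrDr !mulrA [p * F i]mulrC.
Qed.

Lemma mderiv_alongX i : mderiv_along 'X_i = F i.
Proof.
rewrite /mderiv_along (bigD1 i) //= big1 ?addr0 => [|j neq_ji].
  rewrite mderivX mnm1E eqxx -[X in (X - _)%MM]add0m addmK.
  by rewrite mpolyX0 scale1r mulr1.
by rewrite mderivX mnm1E eq_sym (negPf neq_ji) scale0r mulr0.
Qed.

End DerivationAlong.

(** On a monomial, each term trades one factor ['X_j], of degree 1, for [F j], whose degrees are 1
    modulo [d]. *)
Lemma mderiv_along_graded (K : fieldType) (n d : nat)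
    (F : 'I_n -> {mpoly K[n]}) i p :
  (forall j, F j \in graded_part d 1) ->
  p \in graded_part d i -> mderiv_along F p \in graded_part d i.
Proof.
move=> F1 /graded_part_suppP pi; rewrite [p]mpolyE linear_sum big_seq.
apply: rpred_sum => m /pi mi; rewrite linearZ; apply: rpredZ.
apply: rpred_sum => j _; rewrite mderivX -scalerAr.
have [->|mj] := posnP (m j); first by rewrite scale0r rpred0.
apply: rpredZ; rewrite -(eq_graded_part _ mi).
have -> : mdeg m = (1 + mdeg (m - U_(j)))%N.
  rewrite -(mdeg1 j) addnC -mdegD submK //.
  by apply/mnm_lepP => k; rewrite mnm1E; case: eqP => // <-.
by rewrite graded_partM // graded_partX.
Qed.

(** * Extending a derivation from the Veronese subalgebra *)

Section Extension.
Variables (K : fieldType) (n d : nat).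
Hypothesis charK : [pchar K] =i pred0.
Variable D : {linear veronese K n d -> veronese K n d}.
Hypothesis derD : derivation D.

Let charA : [pchar {mpoly K[n]}] =i pred0.
Proof. by move=> p; rewrite pchar_lalg charK. Qed.

Lemma veronese_valM (a b : veronese K n d) :
  veronese_val (a * b) = veronese_val a * veronese_val b.
Proof. exact: rmorphM. Qed.

Lemma veronese_valXn (a : veronese K n d) k :
  veronese_val (a ^+ k) = veronese_val a ^+ k.
Proof. exact: (rmorphXn (@veronese_val K n d)). Qed.

Lemma veronese_valMn (a : veronese K n d) k :
  veronese_val (a *+ k) = veronese_val a *+ k.
Proof. exact: (raddfMn (@veronese_val K n d)). Qed.

Lemma veronese_valD (a b : veronese K n d) :
  veronese_val (a + b) = veronese_val a + veronese_val b.
Proof. exact: (raddfD (@veronese_val K n d)). Qed.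

Fact Xd_graded i : ('X_i ^+ d : {mpoly K[n]}) \in graded_part d 0.
Proof. by rewrite mpolyXn graded_partX mdegMn mdeg1 mul1n modnn mod0n. Qed.

Lemma veronese_XdE : (2 <= n)%N -> (0 < d)%N -> forall i, exists2 F,
  F \in graded_part d 1 &
  veronese_val (D (Veronese (Xd_graded i))) = 'X_i ^+ d.-1 * F *+ d.
Proof.
move=> n_ge2 d_gt0 i.
have [j neq_ij] : exists j, i != j.
  by case: n n_ge2 i => [|[|n']] // _ i; exists (lift i ord0); apply: neq_lift.
set u := Veronese (Xd_graded i); pose v := Veronese (Xd_graded j).
have w_graded : ('X_i * 'X_j ^+ d.-1 : {mpoly K[n]}) \in graded_part d 0.
  rewrite mpolyXn -mpolyXD graded_partX mdegD mdegMn !mdeg1 mul1n add1n.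
  by rewrite prednK // modnn mod0n.
pose w := Veronese w_graded.
have eq_wuv : w ^+ d = u * v ^+ d.-1.
  apply: val_inj; change (veronese_val (w ^+ d) = veronese_val (u * v ^+ d.-1)).
  by rewrite veronese_valM !veronese_valXn exprMn -!exprM mulnC.
have dvd_Du : exists r, veronese_val (D u) = r * 'X_i ^+ d.-1.
  have := congr1 (fun a => veronese_val (D a)) eq_wuv; rewrite derD.
  rewrite (leibnizX derD) veronese_valD veronese_valMn.
  rewrite !veronese_valM !veronese_valXn /=.
  rewrite exprMn -!exprM => Dw.
  (* The cofactor comes from solving the differentiated relation for [v ^+ d.-1 * D u]: both
     [w ^+ d.-1] and [u] contain the factor ['X_i ^+ d.-1]. *)
  apply: (@mpolyXn_dvd_coprime _ _ i j d.-1 (d * d.-1) _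
    ('X_j ^+ (d.-1 * d.-1) * veronese_val (D w) *+ d
      - 'X_i * veronese_val (D (v ^+ d.-1)))) => //.
  rewrite mulrBr -mulrnAr mulrA; rewrite -mulrnAr in Dw; rewrite Dw.
  by rewrite mulrA -exprSr prednK // mulrC addrK.
have [r Dr] := dvd_Du.
have d_neq0 : d%:R != 0 :> K by rewrite (pcharf0P _).1 // -lt0n.
exists (d%:R^-1 *: r).
  (* [D u] has degrees 0 modulo [d], that is [1 + d.-1]; cancelling ['X_i ^+ d.-1] leaves degree
     class 1. *)
  apply: rpredZ; rewrite -(graded_partMX _ _ r (U_(i) *+ d.-1)) -mpolyXn -Dr.
  rewrite mdegMn mdeg1 mul1n add1n prednK //.
  by rewrite (@eq_graded_part _ _ _ d 0) ?modnn ?mod0n //; case: (D u).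
by rewrite [LHS]Dr -scalerAr -scaler_nat scalerA mulfV // scale1r mulrC.
Qed.

Lemma eq_derivation_veronese (E : {linear {mpoly K[n]} -> {mpoly K[n]}}) :
  (0 < d)%N -> derivation E ->
  (forall i, veronese_val (D (Veronese (Xd_graded i))) = E ('X_i ^+ d)) ->
  forall a, veronese_val (D a) = E (veronese_val a).
Proof.
move=> d_gt0 derE DE.
have agree_prod (I : Type) (r : seq I) (F : I -> veronese K n d) :
    (forall i, veronese_val (D (F i)) = E (veronese_val (F i))) ->
    veronese_val (D (\prod_(i <- r) F i)) =
    E (veronese_val (\prod_(i <- r) F i)).
  move=> agreeF.
  apply: (big_ind (fun a => veronese_val (D a) = E (veronese_val a))) => //.
    by rewrite (leibniz1 derD) (leibniz1 derE).
  move=> a b agree_a agree_b.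
  by rewrite derD veronese_valD !veronese_valM derE agree_a agree_b.
have agree_exp k a : veronese_val (D a) = E (veronese_val a) ->
    veronese_val (D (a ^+ k)) = E (veronese_val (a ^+ k)).
  move=> agree_a; rewrite -[k]card_ord -prodr_const -big_enum.
  exact: agree_prod.
(* Agreement at [a ^+ d] reads [d a^(d-1) (D a - E a) = 0], where the first two factors are
   nonzero. *)
have agree_root a : veronese_val a != 0 ->
    veronese_val (D (a ^+ d)) = E (veronese_val (a ^+ d)) ->
    veronese_val (D a) = E (veronese_val a).
  move=> a0; rewrite (leibnizX derD) veronese_valMn veronese_valM.
  rewrite !veronese_valXn (leibnizX derE) => /eqP.
  rewrite -subr_eq0 -mulrnBl -mulrBr -mulr_natr !mulf_eq0 expf_eq0.
  rewrite (negPf a0) andbF /=.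
  by rewrite ((pcharf0P _).1 charA) (gtn_eqF d_gt0) orbF subr_eq0 => /eqP.
have agree_mon m (m_graded : ('X_[m] : {mpoly K[n]}) \in graded_part d 0) :
    veronese_val (D (Veronese m_graded)) = E 'X_[m].
  apply: (agree_root (Veronese m_graded)); first by rewrite -msupp_eq0 msuppX.
  suff -> : Veronese m_graded ^+ d = \prod_i Veronese (Xd_graded i) ^+ m i.
    by apply: agree_prod => i; apply: agree_exp; rewrite DE.
  apply: val_inj.
  rewrite [LHS]veronese_valXn [RHS](rmorph_prod (@veronese_val K n d)) /=.
  rewrite [X in X ^+ d]mpolyXE_id -prodrXl; apply: eq_bigr => i _.
  by rewrite rmorphXn /= exprAC.
case=> p p_graded /=.
have mon_graded m :
    m \in msupp p -> ('X_[m] : {mpoly K[n]}) \in graded_part d 0.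
  move=> mp; rewrite graded_partX; apply/eqP.
  by move/graded_part_suppP: p_graded; apply.
(* The default 0 is never reached for [m] in the support of [p]. *)
pose mon m : veronese K n d := insubd 0 'X_[m].
have monE m : m \in msupp p -> veronese_val (mon m) = 'X_[m].
  by move=> /mon_graded mg; apply: (insubdK (0 : veronese K n d) mg).
have -> : Veronese p_graded = \sum_(m <- msupp p) p@_m *: mon m.
  apply: val_inj.
  rewrite [RHS](linear_sum (@veronese_val K n d)) /= [LHS]mpolyE.
  by rewrite big_seq [RHS]big_seq; apply: eq_bigr => m /monE <-.
rewrite linear_sum [LHS](linear_sum (@veronese_val K n d)).
rewrite {3}[p]mpolyE linear_sum /=.
rewrite big_seq [RHS]big_seq; apply: eq_bigr => m mp.
have eq_mon : mon m = Veronese (mon_graded m mp) by apply/val_inj/monE.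
transitivity (p@_m *: veronese_val (D (mon m))); first by rewrite linearZ.
by rewrite eq_mon agree_mon linearZ.
Qed.

End Extension.

(** * Local nilpotence of the extension *)

Lemma locally_nilpotent_veronese_extension (K : fieldType) (n d : nat)
    (charK : [pchar K] =i pred0) (d_ge2 : (1 < d)%N)
    (D : {linear veronese K n d -> veronese K n d})
    (E : {linear {mpoly K[n]} -> {mpoly K[n]}}) :
  derivation E ->
  (forall i p, p \in graded_part d i -> E p \in graded_part d i) ->
  (forall a : veronese K n d, veronese_val (D a) = E (veronese_val a)) ->
  locally_nilpotent D -> locally_nilpotent E.
Proof.
move=> derE gradedE DE nilD.
have iterDE m (a : veronese K n d) :
    veronese_val (iter m D a) = iter m E (veronese_val a).
  by elim: m => //= m <-.
have nil0 p : p \in graded_part d 0 -> nilpotent_at E p.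
  move=> p0; have [m _ Dm] := nilD (Veronese p0).
  by exists m; rewrite -[p]/(veronese_val (Veronese p0)) -iterDE Dm.
have nilX i : nilpotent_at E 'X_i.
  have charA : [pchar {mpoly K[n]}] =i pred0.
    by move=> q; rewrite pchar_lalg charK.
  have gr_it m : iter m E 'X_i \in graded_part d 1.
    elim: m => [|m IH] /=; last exact: gradedE.
    by rewrite graded_partX mdeg1.
  (* The iterates of ['X_i] stay in degree class 1, so their [d]-th powers fall into the Veronese
     subalgebra, where [E] agrees with [D]. *)
  have nil_it m : nilpotent_at E (iter m E 'X_i ^+ d).
    apply: nil0; rewrite -(@eq_graded_part K n d (d * 1) 0) ?graded_partXn //.
    by rewrite muln1 modnn mod0n.
  exact: (nilpotent_at_root charA derE d_ge2 (nil_it 0) nil_it).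
suff nilE p : nilpotent_at E p.
  by move=> p; have [m Em] := nilE p; exists m.+1; rewrite //= Em raddf0.
(* Nilpotent elements are closed under sums and products, so the variables and the constants, which
   lie in degree class 0, suffice. *)
elim/mpolyind: p => [|c m p _ _ nil_p]; first by exists 0.
apply: nilpotent_atD nil_p; rewrite -mul_mpolyC.
apply: (nilpotent_atM derE).
  by apply: nil0; rewrite -[_%:MP]mulr1 mul_mpolyC rpredZ ?rpred1.
rewrite mpolyXE_id; apply: (nilpotent_at_prod derE) => i.
by rewrite -[m i]card_ord -prodr_const; apply: (nilpotent_at_prod derE).
Qed.

Theorem corollary3 (K : fieldType) (charK : [pchar K] =i pred0)
    (n d : nat) (n_ge2 : (2 <= n)%N) (d_ge2 : (2 <= d)%N)
    (D : {linear veronese K n d -> veronese K n d}) :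
  derivation D -> locally_nilpotent D ->
  exists E : {linear {mpoly K[n]} -> {mpoly K[n]}},
    [/\ derivation E, locally_nilpotent E, d_graded d E
      & forall a : veronese K n d,
          veronese_val (D a) = E (veronese_val a)].
Proof.
move=> derD nilD; have d_gt0 := ltnW d_ge2.
have /fin_all_exists2 [F F1 DF] := veronese_XdE charK derD n_ge2 d_gt0.
have derE : derivation (mderiv_along F) by apply: mderiv_alongM.
have DE : forall a, veronese_val (D a) = mderiv_along F (veronese_val a).
  apply: eq_derivation_veronese => // i.
  by rewrite [LHS]DF (leibnizX derE) -{1}(mderiv_alongX F i).
exists (mderiv_along F); split=> // [|i]; last first.
  by have := F1 i; rewrite -{1}(mderiv_alongX F i).
apply: locally_nilpotent_veronese_extension nilD => // i p.
exact: mderiv_along_graded.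
Qed.
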